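(* Let $K$ be a field and let $\mathsf X$ be a one-sided subshift over a finite or countable alphabet. Then the following are equivalent: (1) $\widetilde{\mathcal A}_K(\mathsf X)_m$ is infinite-dimensional for every $m\in\mathbb Z$; (2) $\widetilde{\mathcal A}_K(\mathsf X)_m$ is infinite-dimensional for some $m\in\mathbb Z$; (3) $\mathsf X$ is infinite.
   Context: Let $\mathscr A$ be a finite or countable alphabet and $\mathsf X\subseteq\mathscr A^{\mathbb N}$ a one-sided subshift (a subset closed for the product of discrete topologies with $\sigma(\mathsf X)\subseteq\mathsf X$), with shift $\sigma(x_0x_1x_2\cdots)=x_1x_2\cdots$. Let $\mathcal L_{\mathsf X}$ be the set of finite words appearing in points of $\mathsf X$, including the empty word $\omega$. For $\alpha,\beta\in\mathcal L_{\mathsf X}$ put $C(\alpha,\beta)=\{\beta x\in\mathsf X:\alpha x\in\mathsf X\}$; for a letter $a$ put $Z_a=\{x\in\mathsf X:x_0=a\}=C(\omega,a)$ and $F_a=\{y\in\mathsf X: ay\in\mathsf X\}$. Let $\mathcal U$ be the Boolean algebra of subsets of $\mathsf X$ generated by all $C(\alpha,\beta)$, and $\widehat{\mathcal U}$ its Stone space of ultrafilters, with topology generated by the sets $O_A=\{\xi\in\widehat{\mathcal U}:A\in\xi\}$, $A\in\mathcal U$. Let $\operatorname{dom}(\widehat\sigma)=\bigcup_{a\in\mathscr A}O_{Z_a}$ and, for $\xi\in O_{Z_a}$, let $\widehat\sigma(\xi)=\{B\in\mathcal U:\{y\in Z_a:\sigma(y)\in B\}\in\xi\}$; this is a local homeomorphism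 $\operatorname{dom}(\widehat\sigma)\to\widehat{\mathcal U}$, mapping $O_{Z_a}$ homeomorphically onto $O_{F_a}$. For a local homeomorphism $\tau:\operatorname{dom}(\tau)\to Y$ with $\operatorname{dom}(\tau)$ open in a totally disconnected locally compact Hausdorff space $Y$ (iterates having their natural domains, $\tau^0=\mathrm{id}_Y$), the Deaconu--Renault groupoid is $G(Y,\tau)=\{(x,k,y)\in Y\times\mathbb Z\times Y:\exists\,m,n\ge0,\ k=m-n,\ x\in\operatorname{dom}(\tau^m),\ y\in\operatorname{dom}(\tau^n),\ \tau^m(x)=\tau^n(y)\}$ with $r(x,k,y)=x$, $s(x,k,y)=y$, $(x,k,y)(y,\ell,z)=(x,k+\ell,z)$, $(x,k,y)^{-1}=(y,-k,x)$ and topology generated by the sets $\{(x,m-n,y):x\in U,y\in V,\tau^m(x)=\tau^n(y)\}$ with $U\subseteq\operatorname{dom}(\tau^m)$, $V\subseteq\operatorname{dom}(\tau^n)$ open and $\tau^m|_U,\tau^n|_V$ homeomorphisms onto their images. It is an ample Hausdorff groupoid, and its Steinberg algebra is $A_K(G(Y,\tau))=\mathrm{span}_K\{1_U:U\text{ a compact open bisection}\}$ with convolution product, $1_U*1_V=1_{UV}$ (a bisection is a set on which $r$ and $s$ are injective). The unital subshift algebra is $\widetilde{\mathcal A}_K(\mathsf X):=A_K(G(\widehat{\mathcal U},\widehat\sigma))$, with $\mathbb Z$-grading induced by $c(\xi,k,\eta)=k$: $\widetilde{\mathcal A}_K(\mathsf X)_m=\mathrm{span}_K\{1_U:U\subseteq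 c^{-1}(m)\text{ a compact open bisection}\}$. *)

(* Defs.v *)
From HB Require Import structures.
From mathcomp Require Import all_boot all_order all_algebra.
From mathcomp Require Import all_classical all_reals all_analysis.

Set Implicit Arguments.
Unset Strict Implicit.
Unset Printing Implicit Defensive.

Import Order.TTheory GRing.Theory Num.Theory.
Local Open Scope classical_set_scope.
Local Open Scope ring_scope.

Definition lin_span (K : fieldType) (L : lmodType K) (S : set L) : set L :=
  [set v | exists (n : nat) (a : 'I_n -> K) (w : 'I_n -> L),
     (forall i, S (w i)) /\ v = \sum_(i < n) a i *: w i].

Definition infinite_dimensional (K : fieldType) (L : lmodType K) (V : set L) :=
  ~ exists2 B : set L, finite_set B & V = lin_span B.

Definition shift (A : Type) (x : nat -> A) : nat -> A := fun n => x n.+1.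

Definition wcat (A : Type) (w : seq A) (x : nat -> A) : nat -> A :=
  fun n => nth (x (n - size w)%N) w n.

Record subshift (A : countType) := Subshift {
  points : set (nat -> A);
  subshift_closed :
    closed (points : set (prod_topology (fun _ : nat => discrete_topology A)));
  subshift_invariant : @shift A @` points `<=` points }.

(* The second disjunct only matters when [X] is empty. *)
Definition language (A : countType) (X : subshift A) : set (seq A) :=
  [set w | (exists2 x, points X x &
              exists i, w = mkseq (fun j => x (i + j)%N) (size w)) \/ w = [::]].

Definition cylC (A : countType) (X : subshift A) (alpha beta : seq A) :
    set (nat -> A) :=
  [set y | exists x, [/\ y = wcat beta x, points X (wcat beta x) &
                         points X (wcat alpha x)]].

Definition Zset (A : countType) (X : subshift A) (a : A) : set (nat -> A) :=
  [set x | points X x /\ x 0%N = a].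

Definition boolean_subalgebra (T : Type) (X : set T) (M : set (set T)) :=
  [/\ M `<=` [set B | B `<=` X], M X, setI_closed M, setU_closed M &
      forall B, M B -> M (X `\` B)].

Definition algU (A : countType) (X : subshift A) : set (set (nat -> A)) :=
  smallest (boolean_subalgebra (points X))
    [set B | exists alpha beta,
       [/\ language X alpha, language X beta & B = cylC X alpha beta]].

Definition proper_filter_in (T : Type) (M xi : set (set T)) :=
  [/\ xi `<=` M, xi !=set0, ~ xi set0, setI_closed xi &
      forall B C, xi B -> M C -> B `<=` C -> xi C].

Definition ultrafilter_in (T : Type) (M xi : set (set T)) :=
  proper_filter_in M xi /\
  forall eta, proper_filter_in M eta -> xi `<=` eta -> eta = xi.

Record stone (A : countType) (X : subshift A) := Stone {
  stone_set : set (set (nat -> A));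
  stoneP : ultrafilter_in (algU X) stone_set }.

HB.instance Definition _ (A : countType) (X : subshift A) :=
  gen_eqMixin (stone X).
HB.instance Definition _ (A : countType) (X : subshift A) :=
  gen_choiceMixin (stone X).
HB.instance Definition _ (A : countType) (X : subshift A) :=
  isSubBaseTopological.Build (stone X)
    (algU X) (fun B : set (nat -> A) => [set xi : stone X | stone_set xi B]).

Lemma boolean_subalgebra_algU (A : countType) (X : subshift A) :
  boolean_subalgebra (points X) (algU X).
Proof.
split=> [B UB| M [[_ MX _ _ _] _]|B C UB UC M HM|B C UB UC M HM|B UB M HM] //.
- apply: (UB [set B | B `<=` points X]); split.
    by split=> //= [C D CX _ x [/CX]|C D CX DX x [/CX|/DX]].
  by move=> _ [alpha [beta [_ _ ->]]] _ [x [-> ]].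
- by have [_ _ HI _ _] := HM.1; apply: HI; [exact: UB|exact: UC].
- by have [_ _ _ HU _] := HM.1; apply: HU; [exact: UB|exact: UC].
- by have [_ _ _ _ HD] := HM.1; apply: HD; exact: UB.
Qed.

Lemma algU_cylC (A : countType) (X : subshift A) (alpha beta : seq A) :
  language X alpha -> language X beta -> algU X (cylC X alpha beta).
Proof. by move=> la lb M [_]; apply; exists alpha, beta. Qed.

Lemma algU_set0 (A : countType) (X : subshift A) : algU X set0.
Proof.
have [_ UX _ _ UD] := boolean_subalgebra_algU X.
by rewrite -(setDv (points X)); exact: UD.
Qed.

Lemma wcat_language (A : countType) (X : subshift A) (w : seq A) x :
  points X (wcat w x) -> language X w.
Proof.
move=> Xwx; left; exists (wcat w x) => //; exists 0%N.
apply: (@eq_from_nth _ (x 0%N)); first by rewrite size_map size_iota.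
move=> i iw; rewrite (nth_map 0%N) ?size_iota// nth_iota// !add0n /wcat.
exact: set_nth_default.
Qed.

Lemma shift_wcat_cons (A : Type) (a : A) w x : shift (wcat (a :: w) x) = wcat w x.
Proof. by []. Qed.

Lemma wcat_shift (A : Type) (x : nat -> A) : wcat [:: x 0%N] (shift x) = x.
Proof. by apply/funext => -[|n] //; rewrite /wcat /shift /= nth_nil subn1. Qed.

Lemma ZsetE (A : countType) (X : subshift A) (a : A) :
  Zset X a = cylC X [::] [:: a].
Proof.
apply/seteqP; split=> [x [Xx <-]|_ [x [-> Xax Xx]]]; last by split.
exists (shift x); rewrite wcat_shift; split=> //.
have -> : wcat [::] (shift x) = shift x.
  by apply/funext => n; rewrite /wcat nth_nil subn0.
by apply: subshift_invariant; exists x.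
Qed.

Lemma algU_Zset (A : countType) (X : subshift A) (a : A) : algU X (Zset X a).
Proof.
rewrite ZsetE; have [lb|nlb] := pselect (language X [:: a]).
  by apply: algU_cylC => //; right.
suff -> : cylC X [::] [:: a] = set0 by exact: algU_set0.
by rewrite -subset0 => _ [x [-> /wcat_language]].
Qed.

Lemma algU_shift (A : countType) (X : subshift A) (a : A) B :
  algU X B -> algU X (Zset X a `&` @shift A @^-1` B).
Proof.
have [UsubX UX UI UU UD] := boolean_subalgebra_algU X.
have Xshift x : points X x -> points X (shift x).
  by move=> Xx; apply: subshift_invariant; exists x.
have UZ := @algU_Zset A X a.
suff : algU X `<=` [set B | B `<=` points X /\ algU X (Zset X a `&` @shift A @^-1` B)].
  by move=> /(_ B)/[apply] -[].
apply: smallest_sub; first split.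
- by move=> C [].
- split=> //; suff -> : Zset X a `&` @shift A @^-1` points X = Zset X a by [].
  by apply/setIidPl => x [/Xshift].
- move=> C D [CX UC] [DX UD']; split; first by move=> x [/CX].
  by rewrite preimage_setI setIIr; exact: UI.
- move=> C D [CX UC] [DX UD']; split; first by move=> x [/CX|/DX].
  by rewrite preimage_setU setIUr; exact: UU.
- move=> C [CX UC]; split; first by move=> x [].
  suff -> : Zset X a `&` @shift A @^-1` (points X `\` C) =
      Zset X a `&` (points X `\` (Zset X a `&` @shift A @^-1` C)).
    by apply: UI => //; exact: UD.
  apply/seteqP; split=> x [Zx [Xx nC]].
    by split=> //; split; [exact: Zx.1|move=> [_]].
  by split=> //; split=> [|Cx]; [exact/Xshift|exact: nC].
- move=> _ [alpha [beta [la lb ->]]]; split; first by move=> _ [x [->]].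
  suff -> : Zset X a `&` @shift A @^-1` (cylC X alpha beta) =
      cylC X alpha (a :: beta).
    have [lab|nlab] := pselect (language X (a :: beta)); first exact: algU_cylC.
    suff -> : cylC X alpha (a :: beta) = set0 by exact: algU_set0.
    by rewrite -subset0 => _ [x [-> /wcat_language]].
  apply/seteqP; split=> [y [[Xy ya] [x [yx Xb Xal]]]|_ [x [-> Xab Xal]]].
    have yE : y = wcat (a :: beta) x.
      rewrite -(wcat_shift y) ya yx.
      by apply/funext => -[|n] //; rewrite /wcat /= nth_nil subn1.
    by exists x; rewrite -yE.
  by split=> //; exists x; split=> //; rewrite -(shift_wcat_cons a); exact: Xshift.
Qed.

Lemma ultrafilter_prime (T : Type) (X : set T) (M xi : set (set T)) :
  boolean_subalgebra X M -> ultrafilter_in M xi ->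
  forall B, M B -> xi B \/ xi (X `\` B).
Proof.
move=> MX [[xiM [C0 xiC0] xi0 xiI xiS] xi_max] B MB; have [MsubX MXX MI MU MD] := MX.
have [[C xiC CB0]|noC] := pselect (exists2 C, xi C & C `&` B = set0).
  right; apply: (xiS C) => //; first exact: MD.
  move=> x Cx; split; first exact: (MsubX _ (xiM _ xiC)).
  by move=> Bx; have : (C `&` B) x by []; rewrite CB0.
left; pose eta := [set D | M D /\ exists2 C, xi C & C `&` B `<=` D].
have <- : eta = xi.
  apply: xi_max.
    split=> [D []//| | [_ [C xiC]]| D E [MD' [C xiC CD]] [ME [C' xiC' CE]]
            | D E [MD' [C xiC CD]] ME DE].
    - by exists B; split=> //; exists C0 => // x [].
    - by rewrite subset0 => CB; apply: noC; exists C.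
    - split; first exact: MI.
      exists (C `&` C'); first exact: xiI.
      by move=> x [[Cx C'x] Bx]; split; [exact: CD|exact: CE].
    - by split=> //; exists C => //; exact: subset_trans DE.
  by move=> D xiD; split; [exact: xiM|exists D => // x []].
by split=> //; exists C0 => // x [].
Qed.

Lemma prime_ultrafilter (T : Type) (X : set T) (M xi : set (set T)) :
  proper_filter_in M xi ->
  (forall B, M B -> xi B \/ xi (X `\` B)) -> ultrafilter_in M xi.
Proof.
move=> xiF xi_prime; split=> // eta [etaM _ eta0 etaI _] xieta.
apply/seteqP; split=> // B etaB; have [//|xiXB] := xi_prime _ (etaM _ etaB).
exfalso; apply: eta0; suff <- : B `&` (X `\` B) = set0.
  by apply: etaI => //; exact: xieta.
by rewrite -subset0 => x [Bx [_]].
Qed.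

Definition shift_hat_dom (A : countType) (X : subshift A) : set (stone X) :=
  \bigcup_(a in [set: A]) [set xi : stone X | stone_set xi (Zset X a)].

(* The letter [a] is unique, because the sets [Zset X a] are disjoint. *)
Definition shift_hat_set (A : countType) (X : subshift A) (xi : stone X) :
    set (set (nat -> A)) :=
  [set B | algU X B /\ exists2 a, stone_set xi (Zset X a) &
                         stone_set xi (Zset X a `&` @shift A @^-1` B)].

Lemma ultrafilter_shift_hat (A : countType) (X : subshift A) (xi : stone X) :
  shift_hat_dom xi -> ultrafilter_in (algU X) (shift_hat_set xi).
Proof.
move=> [a _ /= xia].
have [UsubX UX UI UU UD] := boolean_subalgebra_algU X.
have [[xiU _ xi0 xiI xiS] _] := stoneP xi.
have hatE B : shift_hat_set xi B <->
    algU X B /\ stone_set xi (Zset X a `&` @shift A @^-1` B).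
  split=> [[UB [b xib xibB]]|[UB xiaB]]; last by split=> //; exists a.
  split=> //; apply: (xiS _ _ (xiI _ _ xia xibB)); first exact: algU_shift.
  by move=> x [Zx [_ Bx]].
apply: (@prime_ultrafilter _ (points X)).
  split=> [B []//| |/hatE[_]|B C /hatE[UB xiB] /hatE[UC xiC]
          |B C /hatE[UB xiB] UC BC].
  - exists (points X); apply/hatE; split=> //.
    suff -> : Zset X a `&` @shift A @^-1` points X = Zset X a by [].
    apply/setIidPl => x [Xx _]; apply: subshift_invariant; by exists x.
  - by rewrite preimage_set0 setI0.
  - apply/hatE; split; first exact: UI.
    by rewrite preimage_setI setIIr; exact: xiI.
  - apply/hatE; split=> //; apply: (xiS _ _ xiB); first exact: algU_shift.
    by move=> x [Zx /BC].
move=> B UB; have UaB := algU_shift a UB.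
have [xiB|xinB] := ultrafilter_prime (boolean_subalgebra_algU X) (stoneP xi) UaB.
  by left; apply/hatE.
right; apply/hatE; split; first exact: UD.
apply: (xiS _ _ (xiI _ _ xia xinB)); first by apply: algU_shift; exact: UD.
move=> x [Zx [Xx nBx]]; split=> //; split; last by move=> Bx; exact: nBx.
by apply: subshift_invariant; exists x.
Qed.

(* Outside of [shift_hat_dom X] the value is irrelevant. *)
Definition shift_hat (A : countType) (X : subshift A) (xi : stone X) : stone X :=
  if pselect (shift_hat_dom xi) is left xidom
  then Stone (ultrafilter_shift_hat xidom) else xi.

(* A partial map is given by its domain [D] and a total function [tau] whose
   values outside of [D] are irrelevant; [iter_dom D tau n] is the natural
   domain of the [n]-th iterate. *)
Definition iter_dom (Y : Type) (D : set Y) (tau : Y -> Y) (n : nat) : set Y :=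
  [set x | forall i, (i < n)%N -> D (iter i tau x)].

Record dr_groupoid (Y : Type) (D : set Y) (tau : Y -> Y) := DRGroupoid {
  dr_range : Y;
  dr_lag : int;
  dr_source : Y;
  dr_groupoidP : exists m n : nat,
    [/\ dr_lag = m%:Z - n%:Z, iter_dom D tau m dr_range,
        iter_dom D tau n dr_source & iter m tau dr_range = iter n tau dr_source] }.

Definition homeo_onto_image (Y : topologicalType) (U : set Y) (f : Y -> Y) :=
  {within U, continuous f} /\
  exists g : Y -> Y, {within f @` U, continuous g} /\ {in U, cancel f g}.

Definition iter_chart (Y : topologicalType) (D : set Y) (tau : Y -> Y) (n : nat)
    (U : set Y) :=
  [/\ open U, U `<=` iter_dom D tau n & homeo_onto_image U (iter n tau)].

HB.instance Definition _ (Y : Type) (D : set Y) (tau : Y -> Y) :=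
  gen_eqMixin (dr_groupoid D tau).
HB.instance Definition _ (Y : Type) (D : set Y) (tau : Y -> Y) :=
  gen_choiceMixin (dr_groupoid D tau).

Definition dr_charts (Y : topologicalType) (D : set Y) (tau : Y -> Y) :
    set ((nat * nat) * (set Y * set Y)) :=
  [set i | iter_chart D tau i.1.1 i.2.1 /\ iter_chart D tau i.1.2 i.2.2].

Definition dr_basic_open (Y : topologicalType) (D : set Y) (tau : Y -> Y)
    (i : (nat * nat) * (set Y * set Y)) : set (dr_groupoid D tau) :=
  [set g | [/\ i.2.1 (dr_range g), i.2.2 (dr_source g),
               dr_lag g = i.1.1%:Z - i.1.2%:Z &
               iter i.1.1 tau (dr_range g) = iter i.1.2 tau (dr_source g)]].

HB.instance Definition _ (Y : topologicalType) (D : set Y) (tau : Y -> Y) :=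
  isSubBaseTopological.Build (dr_groupoid D tau)
    (dr_charts D tau) (@dr_basic_open Y D tau).

Definition compact_open_bisection (Y : topologicalType) (D : set Y)
    (tau : Y -> Y) (U : set (dr_groupoid D tau)) :=
  [/\ compact U, open U, set_inj U (@dr_range _ D tau) &
      set_inj U (@dr_source _ D tau)].

(* The part of the Steinberg algebra spanned by the indicator functions of
   compact open bisections contained in [W]: the whole algebra for [W = setT],
   and the homogeneous component of degree [m] for [W] the preimage of [m]
   under the lag cocycle.  Only the [K]-linear structure is recorded, since the
   convolution product does not affect dimensions. *)
Definition steinberg_on (K : fieldType) (Y : topologicalType) (D : set Y)
    (tau : Y -> Y) (W : set (dr_groupoid D tau)) :
    set (dr_groupoid D tau -> K^o) :=
  lin_span [set f | exists2 U : set (dr_groupoid D tau),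
                      compact_open_bisection U /\ U `<=` W & f = \1_U].

Arguments steinberg_on K {Y D tau} W.

Definition subshift_algebra (K : fieldType) (A : countType) (X : subshift A) :=
  steinberg_on K [set: dr_groupoid (@shift_hat_dom A X) (@shift_hat A X)].

Definition subshift_algebra_deg (K : fieldType) (A : countType) (X : subshift A)
    (m : int) :=
  steinberg_on K
    [set g : dr_groupoid (@shift_hat_dom A X) (@shift_hat A X) | dr_lag g = m].

Arguments subshift_algebra K {A} X.
Arguments subshift_algebra_deg K {A} X m.

(* Main.v *)
Require Import Defs.
From mathcomp Require Import all_boot all_order all_algebra.
From mathcomp Require Import all_classical all_reals all_analysis.
From mathcomp Require Import finmap.

Set Implicit Arguments.
Unset Strict Implicit.
Unset Printing Implicit Defensive.

(* Below, [shift] is the shift of sequences, not the translation of a function. *)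
Import Defs.
Import Order.TTheory GRing.Theory Num.Theory.
Local Open Scope classical_set_scope.
Local Open Scope ring_scope.

(** Degree [m] of the Steinberg algebra consists of functions on the clopen part
    [c^-1(m)] of the groupoid, so its dimension is governed by how many points
    of that part compact open bisections can tell apart.

    If the subshift is finite, then so are the Boolean algebra, its Stone space
    and [c^-1(m)], since an arrow is determined by its range, its lag and its
    source; hence degree [m] is spanned by finitely many indicator functions
    ([finite_dimensional_subshift_algebra_deg]).

    If the subshift is infinite, take [N] distinct points [x_i] of it.  Their
    prefixes [w_i] of a common length [k], which may be taken larger than any
    given [n], are already distinct ([separating_prefixes]), and the cylinder of
    [w_i] contains [x_j] only if [i = j].  On the compact open set of
    ultrafilters containing that cylinder the [n]-th iterate of the shift is
    defined, and it is a homeomorphism onto its image because its inverse only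
    puts a fixed word back in front of sequences ([cylinder_chart]).  The graph
    [{(xi, n, sigma^n xi)}] over that set is therefore a compact open bisection
    of degree [n] ([iterate_graph_bisection]).  It contains the arrow of degree
    [n] from the principal ultrafilter at [x_j] to its [n]-th image only if
    [i = j], so the [N] indicator functions of these graphs are linearly
    independent ([infinite_dimensional_dual]).  Degree [-n] follows by inverting arrows
    ([compact_open_bisection_inv]). *)

(** * Dimension and finiteness *)

Lemma finite_powerset (T : choiceType) (S : set T) :
  finite_set S -> finite_set [set B | B `<=` S].
Proof.
move=> /finite_fsetP[s ->].
apply: (@sub_finite_set _ _ ((fun t : {fset T} => [set` t]) @` [set` fpowerset s])).
  move=> B Bs; have /finite_fsetP[t Bt] : finite_set B.
    exact/(sub_finite_set Bs)/finite_fset.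
  exists t => //=; rewrite fpowersetE; apply/fsubsetP => x xt.
  by apply: Bs; rewrite Bt.
exact/finite_image/finite_fset.
Qed.

(** Evaluation at the [g j] is a linear map to row vectors of length [N].  If [V]
    were spanned by finitely many vectors, then for [N] larger than their number
    the image of [V] would have rank less than [N], although it contains the
    canonical basis, the image of the [f i]. *)
Lemma infinite_dimensional_dual (K : fieldType) (T : Type)
    (V : set (T -> K^o)) :
  (forall N, exists (f : 'I_N -> T -> K^o) (g : 'I_N -> T),
     forall i, V (f i) /\ forall j, f i (g j) = (i == j)%:R) ->
  infinite_dimensional V.
Proof.
move=> dual [B /finite_seqP[s sB] VE].
have [f [g fg]] := dual (size s).+1.
pose ev (v : T -> K^o) : 'rV[K]_(size s).+1 := \row_j v (g j).
pose M := \matrix_(k < size s) ev (nth 0 s k).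
have evM v : V v -> (ev v <= M)%MS.
  rewrite VE => -[n [a [w [Bw ->]]]].
  have -> : ev (\sum_(i < n) a i *: w i) = \sum_(i < n) a i *: ev (w i).
    apply/rowP => j; rewrite mxE summxE fct_sumE.
    by apply: eq_bigr => i _; rewrite !mxE.
  apply: summx_sub => i _; apply: scalemx_sub.
  have wis : w i \in s by move: (Bw i); rewrite sB.
  have lt_s : (index (w i) s < size s)%N by rewrite index_mem.
  by have := row_sub (Ordinal lt_s) M; rewrite rowK /= nth_index.
have : (1%:M <= M)%MS.
  apply/row_subP => i; have [Vf fE] := fg i.
  suff -> : row i 1%:M = ev (f i) by exact: evM.
  by apply/rowP => j; rewrite !mxE fE.
by move=> /mxrankS; rewrite mxrank1 leqNgt ltnS rank_leq_row.
Qed.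

Lemma lin_span_mem (K : fieldType) (L : lmodType K) (S : set L) v :
  S v -> lin_span S v.
Proof.
move=> Sv; exists 1%N, (fun=> 1), (fun=> v); split=> //.
by rewrite big_ord1 scale1r.
Qed.

(** * Topologies given by a subbase *)

Lemma fmap_ultra (T U : Type) (f : T -> U) (F : set_system T) :
  UltraFilter F -> UltraFilter (f @ F).
Proof.
move=> FU; apply: Build_UltraFilter => G GP FG; apply/seteqP; split=> // A GA.
have [//|FnA] := in_ultra_setVsetC (f @^-1` A) FU.
exfalso; apply: (@filter_not_empty _ G); rewrite -(setICr A).
by apply: filterI => //; exact: FG.
Qed.

(** For the topologies of the Stone space and of the groupoid this equation holds
    by definition. *)
Definition subbase (T : topologicalType) (I : choiceType) (D : set I)
    (b : I -> set T) :=
  (open : set_system T) =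
    [set \bigcup_(B in D') B | D' in subset^~ (finI_from D b)].

Lemma subbase_open (T : topologicalType) (I : choiceType) (D : set I)
    (b : I -> set T) i :
  subbase D b -> D i -> open (b i).
Proof.
move=> -> Di; exists [set b i]; first by move=> _ ->; exact: finI_from1.
by rewrite bigcup_set1.
Qed.

Lemma subbase_cvg (T : topologicalType) (I : choiceType) (D : set I)
    (b : I -> set T) (F : set_system T) (p : T) :
  subbase D b -> Filter F -> (forall i, D i -> b i p -> F (b i)) -> F --> p.
Proof.
move=> openE FF Fb A; rewrite /= nbhsE => -[B [oB Bp] BA].
move: oB Bp BA; rewrite openE => -[D' D'fin <-] [C D'C Cp] BA.
have CA : C `<=` A by move=> x Cx; apply: BA; exists C.
suff : F C by exact: filterS.
have [J /= JD CE] := D'fin _ D'C.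
rewrite -CE; apply: filter_bigI => i iJ; apply: Fb.
  exact: set_mem (JD _ iJ).
by move: Cp; rewrite -CE; apply.
Qed.

Lemma subbase_cvg_map (S : Type) (T : topologicalType) (I : choiceType)
    (D : set I) (b : I -> set T) (f : S -> T) (F : set_system S) (p : T) :
  subbase D b -> Filter F -> (forall i, D i -> b i p -> F (f @^-1` b i)) ->
  f @ F --> p.
Proof.
by move=> openE FF; apply: subbase_cvg openE _; exact: fmap_filter.
Qed.

Lemma subbase_continuous (S T : topologicalType) (I : choiceType)
    (D : set I) (b : I -> set T) (f : S -> T) (x : S) :
  subbase D b -> (forall i, D i -> b i (f x) -> nbhs x (f @^-1` b i)) ->
  {for x, continuous f}.
Proof. by move=> openE ?; apply: (subbase_cvg_map openE). Qed.

(** * Bisections of Deaconu-Renault groupoids *)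

Lemma iter_domS (Y : Type) (D : set Y) (tau : Y -> Y) n x :
  D x -> iter_dom D tau n (tau x) -> iter_dom D tau n.+1 x.
Proof. by move=> Dx Dn [//|i] /Dn; rewrite iterSr. Qed.

Section groupoid.
Variables (Y : topologicalType) (D : set Y) (tau : Y -> Y).
Local Notation G := (dr_groupoid D tau).
Implicit Types (g : G) (n : nat).

Lemma dr_groupoid_eq g h :
  dr_range g = dr_range h -> dr_lag g = dr_lag h ->
  dr_source g = dr_source h -> g = h.
Proof.
case: g h => [x k y gP] [x' k' y' hP] /= xx' kk' yy'.
by subst; congr DRGroupoid; exact: Prop_irrelevance.
Qed.

Lemma dr_charts_subbase : subbase (dr_charts D tau) (@dr_basic_open Y D tau).
Proof. by []. Qed.

Lemma iter_chart0 : iter_chart D tau 0 setT.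
Proof.
split=> //; first exact: openT.
split; first by apply: continuous_subspaceT => x; exact: cvg_id.
by exists id; split => //; apply: continuous_subspaceT => x; exact: cvg_id.
Qed.

(** The arrows [(x, n, tau^n x)] with [x] in [U], presented as a basic open set so
    that openness is immediate. *)
Definition iterate_graph n (U : set Y) : set G :=
  dr_basic_open ((n, 0%N), (U, setT)).

Lemma iterate_graphE n U g : iterate_graph n U g <->
  [/\ U (dr_range g), dr_lag g = n & iter n tau (dr_range g) = dr_source g].
Proof.
by rewrite /iterate_graph /dr_basic_open /= subr0; split=> [[]|[]].
Qed.

Lemma iterate_graph_point n U x : iter_dom D tau n x -> U x ->
  exists2 g : G, dr_range g = x & iterate_graph n U g.
Proof.
move=> nx Ux.
have gP : exists p q : nat, [/\ n%:Z = p%:Z - q%:Z, iter_dom D tau p x,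
    iter_dom D tau q (iter n tau x) & iter p tau x = iter q tau (iter n tau x)].
  by exists n, 0%N; split=> //; rewrite subr0.
by exists (DRGroupoid gP) => //; apply/iterate_graphE.
Qed.

(** The range map is injective on the graph because the source is a function of
    the range, and the source map because [tau^n] is injective on [U].  Compactness
    comes from [U]: the ranges along an ultrafilter of arrows converge to some
    [x] in [U], and then the arrows converge to [(x, n, tau^n x)], since on the
    graph a basic open set only constrains [x] and [tau^n x]. *)
Lemma iterate_graph_bisection n U : iter_chart D tau n U -> compact U ->
  (forall x, U x -> {for x, continuous (iter n tau)}) ->
  compact_open_bisection (iterate_graph n U).
Proof.
move=> Uchart Ucompact tau_cont; have [_ Udom [_ [h [_ hK]]]] := Uchart.
split.
- rewrite compact_ultra => F FU FS.
  pose F' := (@dr_range Y D tau) @ F.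
  have F'U : UltraFilter F' by exact: fmap_ultra.
  have F'S : F (@dr_range Y D tau @^-1` U).
    by apply: filterS FS => g /iterate_graphE[].
  move: Ucompact; rewrite compact_ultra => /(_ F' F'U F'S)[x [Ux F'x]].
  have [g gx Sg] := iterate_graph_point (Udom _ Ux) Ux.
  exists g; split=> //; apply: (subbase_cvg dr_charts_subbase).
  move=> [[p q] [V W]] [/= [oV _ _] [oW _ _]] [/= Vg Wg gpq gE].
  have [_ gn gs] := (iterate_graphE _ _ _).1 Sg.
  have FV : F (@dr_range Y D tau @^-1` V).
    by apply: F'x; apply: open_nbhs_nbhs; rewrite -gx.
  have FW : F (@dr_range Y D tau @^-1` (iter n tau @^-1` W)).
    by apply: F'x; apply: tau_cont => //; apply: open_nbhs_nbhs; rewrite -gx gs.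
  apply: filterS (filterI FS (filterI FV FW)) => k [/iterate_graphE[Uk kn ks]].
  move=> [Vk]; rewrite /= ks => Wk.
  (* Since [n = p - q], the equation [tau^p (range) = tau^q (source)] defining
     the basic open set holds on the whole graph. *)
  have npq : (p = q + n)%N.
    by apply/eqP; rewrite addnC -eqz_nat PoszD -subr_eq -gn gpq.
  by split=> //=; [rewrite kn -gpq gn|rewrite npq iterD ks].
- by apply: subbase_open dr_charts_subbase _; split=> //; exact: iter_chart0.
- move=> g k /set_mem/iterate_graphE[_ gn gs] /set_mem/iterate_graphE[_ kn ks] gk.
  by apply: dr_groupoid_eq => //; rewrite ?gn// -gs -ks gk.
- move=> g k /set_mem/iterate_graphE[Ug gn gs] /set_mem/iterate_graphE[Uk kn ks] gk.
  apply: dr_groupoid_eq => //; last by rewrite gn.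
  by rewrite -(hK _ (mem_set Ug)) -(hK _ (mem_set Uk)) gs ks gk.
Qed.

Lemma dr_inv_subproof g : exists m n : nat,
  [/\ - dr_lag g = m%:Z - n%:Z, iter_dom D tau m (dr_source g),
      iter_dom D tau n (dr_range g) &
      iter m tau (dr_source g) = iter n tau (dr_range g)].
Proof.
have [m [n [gmn gm gn gE]]] := dr_groupoidP g.
by exists n, m; split=> //; rewrite gmn opprB.
Qed.

Definition dr_inv g : G := DRGroupoid (dr_inv_subproof g).

Lemma dr_invK : involutive dr_inv.
Proof. by move=> g; apply: dr_groupoid_eq => //=; rewrite opprK. Qed.

Lemma dr_inv_continuous : continuous dr_inv.
Proof.
move=> g; apply: (subbase_continuous dr_charts_subbase).
move=> [[p q] [V W]] [/= chV chW] [/= Vg Wg gpq gE].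
have oWV : open (dr_basic_open ((q, p), (W, V)) : set G).
  by apply: subbase_open dr_charts_subbase _; split.
suff : nbhs g (dr_basic_open ((q, p), (W, V)) : set G).
  apply: filterS => k [/= Wk Vk kqp kE]; split=> //=.
  by rewrite kqp opprB.
apply: open_nbhs_nbhs; split=> //; split=> //=.
by rewrite -[LHS]opprK gpq opprB.
Qed.

Lemma compact_open_bisection_inv (S : set G) :
  compact_open_bisection S -> compact_open_bisection (dr_inv @^-1` S).
Proof.
move=> [Sc So Sr Ss]; split.
- have -> : dr_inv @^-1` S = dr_inv @` S.
    apply/seteqP; split=> [g Sg|_ [g Sg <-]].
      by exists (dr_inv g) => //; rewrite dr_invK.
    by rewrite /= dr_invK.
  by apply: continuous_compact => //; exact/continuous_subspaceT/dr_inv_continuous.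
- by apply: open_comp => // g _; exact: dr_inv_continuous.
- move=> g k /set_mem Sg /set_mem Sk gk; apply: (can_inj dr_invK).
  by apply: Ss => //; exact: mem_set.
- move=> g k /set_mem Sg /set_mem Sk gk; apply: (can_inj dr_invK).
  by apply: Sr => //; exact: mem_set.
Qed.

End groupoid.

(** * Prepending words *)

Lemma wcat_nil (A : Type) (x : nat -> A) : wcat [::] x = x.
Proof. by apply/funext => n; rewrite /wcat nth_nil subn0. Qed.

Lemma wcat_cat (A : Type) (u v : seq A) x : wcat (u ++ v) x = wcat u (wcat v x).
Proof.
elim: u => [|a u IH]; first by rewrite wcat_nil.
by apply/funext => -[//|n]; exact: (congr1 (@^~ n) IH).
Qed.

Lemma preimage_wcat_nil (A : Type) (B : set (nat -> A)) : wcat [::] @^-1` B = B.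
Proof. by apply/seteqP; split=> x; rewrite /= wcat_nil. Qed.

Lemma preimage_wcat_cons (A : Type) (a : A) w (B : set (nat -> A)) :
  wcat (a :: w) @^-1` B = wcat w @^-1` (wcat [:: a] @^-1` B).
Proof. by apply/seteqP; split=> x; rewrite /= -(cat1s a w) wcat_cat. Qed.

Lemma mkseqS_shift (A : Type) (x : nat -> A) n :
  mkseq x n.+1 = x 0%N :: mkseq (shift x) n.
Proof. by rewrite /mkseq /= (iotaDl 1 0) -map_comp. Qed.

(** * The Stone space of a subshift *)

Section subshift.
Variables (A : countType) (X : subshift A).
Implicit Types (xi : stone X) (B : set (nat -> A)).
Local Notation sigma := (@shift_hat A X).

Definition stone_basic B : set (stone X) := [set xi | stone_set xi B].

Lemma stone_subbase : subbase (algU X) stone_basic.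
Proof. by []. Qed.

Lemma points_shift x : points X x -> points X (shift x).
Proof. by move=> Xx; apply: subshift_invariant; exists x. Qed.

Lemma algU_cylC_any alpha beta : algU X (cylC X alpha beta).
Proof.
have [la|nla] := pselect (language X alpha); last first.
  suff -> : cylC X alpha beta = set0 by exact: algU_set0.
  by rewrite -subset0 => _ [x [-> _ /wcat_language]].
have [lb|nlb] := pselect (language X beta); first exact: algU_cylC.
suff -> : cylC X alpha beta = set0 by exact: algU_set0.
by rewrite -subset0 => _ [x [-> /wcat_language]].
Qed.

(** Prepending [a] to the points of a generator is compatible with the Boolean
    operations relative to the follower set [F_a = C(a, [::])].  The preimage of
    [C(alpha, a beta)] is [F_a `&` C(alpha, beta)], that of [C(alpha, b beta)] is
    empty when [b != a], and that of [C(alpha, [::])] is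
    [F_a `&` C(alpha a, [::])]. *)
Lemma algU_wcat1 a B : algU X B -> algU X (wcat [:: a] @^-1` B).
Proof.
have [UsubX UX UI UU UD] := boolean_subalgebra_algU X.
have wX x : points X (wcat [:: a] x) -> points X x.
  by move=> /points_shift; rewrite shift_wcat_cons wcat_nil.
have FE : cylC X [:: a] [::] = wcat [:: a] @^-1` points X.
  apply/seteqP; split=> [_ [x [-> _ ?]]|x /= Xax]; first by rewrite wcat_nil.
  by exists x; rewrite wcat_nil; split=> //; exact: wX.
suff : algU X `<=` [set B | B `<=` points X /\ algU X (wcat [:: a] @^-1` B)].
  by move=> /(_ B)/[apply] -[].
apply: smallest_sub; first split.
- by move=> C [].
- by split=> //; rewrite -FE; exact: algU_cylC_any.
- move=> C E [CX UC] [EX UE]; split; first by move=> x [/CX].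
  by rewrite preimage_setI; exact: UI.
- move=> C E [CX UC] [EX UE]; split; first by move=> x [/CX|/EX].
  by rewrite preimage_setU; exact: UU.
- move=> C [CX UC]; split; first by move=> x [].
  have -> : wcat [:: a] @^-1` (points X `\` C) =
      cylC X [:: a] [::] `&` (points X `\` (wcat [:: a] @^-1` C)).
    rewrite FE; apply/seteqP; split=> x.
      by move=> [Xax nC]; split=> //; split=> //; exact: wX.
    by move=> [Xax [_ nC]].
  by apply: UI; [exact: algU_cylC_any|exact: UD].
move=> _ [alpha [[|b beta] [_ _ ->]]]; (split; first by move=> _ [x [->]]).
  have -> : wcat [:: a] @^-1` cylC X alpha [::] =
      cylC X [:: a] [::] `&` cylC X (rcons alpha a) [::].
    apply/seteqP; split=> [y /= [x []]|y []].
      rewrite wcat_nil => <- Xay Xaay; split; exists y; rewrite wcat_nil;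
        split=> //; try exact: wX.
      by rewrite -cats1 wcat_cat.
    move=> [x []]; rewrite wcat_nil => -> _ Xax [z []]; rewrite wcat_nil => <- _.
    rewrite -cats1 wcat_cat => Xaax.
    by exists (wcat [:: a] x); rewrite wcat_nil; split.
  by apply: UI; exact: algU_cylC_any.
have [->|ba] := eqVneq b a; last first.
  suff -> : wcat [:: a] @^-1` cylC X alpha (b :: beta) = set0.
    exact: algU_set0.
  rewrite -subset0 => y [x [/(congr1 (@^~ 0%N))]].
  by rewrite /wcat /= => ab; rewrite ab eqxx in ba.
have -> : wcat [:: a] @^-1` cylC X alpha (a :: beta) =
    cylC X [:: a] [::] `&` cylC X alpha beta.
  rewrite FE; apply/seteqP; split=> [y /= [x [yx Xx Xax]]|].
    split; first by rewrite /= yx.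
    have -> : y = wcat beta x.
      by rewrite -(wcat_nil y) -(shift_wcat_cons a) yx.
    by exists x; split=> //; exact: points_shift Xx.
  move=> y [Xay [x [yx Xx Xax]]]; exists x.
  by rewrite -(cat1s a beta) wcat_cat -yx.
by apply: UI; exact: algU_cylC_any.
Qed.

Lemma algU_wcat w B : algU X B -> algU X (wcat w @^-1` B).
Proof.
elim: w B => [|a w IH] B UB; first by rewrite preimage_wcat_nil.
by rewrite preimage_wcat_cons; apply: IH; exact: algU_wcat1.
Qed.

Definition cylinder w : set (nat -> A) :=
  [set x | points X x /\ mkseq x (size w) = w].

Lemma cylinder_cons a w :
  cylinder (a :: w) = Zset X a `&` @shift A @^-1` cylinder w.
Proof.
rewrite /cylinder; apply/seteqP; split=> x /=; rewrite mkseqS_shift.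
  by move=> [Xx [xa xw]]; do !split=> //; exact: points_shift.
by move=> [[Xx ->] [_ ->]].
Qed.

Lemma algU_cylinder w : algU X (cylinder w).
Proof.
have [_ UX _ _ _] := boolean_subalgebra_algU X.
elim: w => [|a w IH]; last by rewrite cylinder_cons; exact: algU_shift.
by rewrite (_ : cylinder [::] = points X) //; apply/seteqP; split=> [x []|x].
Qed.

Lemma stone_set_sub xi B C :
  algU X C -> B `<=` C -> stone_set xi B -> stone_set xi C.
Proof. by have [[_ _ _ _ xiS] _] := stoneP xi => UC BC xiB; exact: xiS BC. Qed.

Lemma stone_setI xi B C : algU X B -> algU X C ->
  stone_set xi (B `&` C) <-> stone_set xi B /\ stone_set xi C.
Proof.
have [[_ _ _ xiI _] _] := stoneP xi => UB UC; split=> [xiBC|[]]; last exact: xiI.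
by split; apply: stone_set_sub xiBC => // x [].
Qed.

Lemma stone_ext xi eta :
  (forall B, algU X B -> stone_set xi B <-> stone_set eta B) -> xi = eta.
Proof.
have [[xiU _ _ _ _] _] := stoneP xi; have [[etaU _ _ _ _] _] := stoneP eta.
case: xi eta xiU etaU => [s sP] [t tP] /= sU tU st.
have : s = t by apply/seteqP; split=> B ?; apply/(st B) => //; auto.
by move=> eq_st; subst; congr Stone; exact: Prop_irrelevance.
Qed.

Lemma shift_hatE a xi B : stone_basic (Zset X a) xi ->
  stone_set (sigma xi) B <->
  algU X B /\ stone_set xi (Zset X a `&` @shift A @^-1` B).
Proof.
move=> xia; rewrite /shift_hat; case: pselect => [dxi|[]]; last by exists a.
split=> /= -[UB]; last by move=> xiB; split=> //; exists a.
move=> [b xib xibB]; split=> //.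
apply: stone_set_sub ((stone_setI xi _ _).2 (conj xia xibB)).
- exact: algU_shift.
- by move=> x [Zx [_ Bx]].
- exact: algU_Zset.
- exact: algU_shift.
Qed.

(** Every point of [Z_a] is [a] followed by its shift.  Hence an ultrafilter
    containing [Z_a] can be recovered from its image under the shift. *)
Lemma shift_hat_wcat a xi B : stone_basic (Zset X a) xi -> algU X B ->
  stone_set xi B <-> stone_set (sigma xi) (wcat [:: a] @^-1` B).
Proof.
move=> xia UB; rewrite (shift_hatE _ xia).
have -> : Zset X a `&` @shift A @^-1` (wcat [:: a] @^-1` B) = Zset X a `&` B.
  by apply/seteqP; split=> x [[Xx <-]]; rewrite /= wcat_shift.
rewrite stone_setI//; last exact: algU_Zset.
by split=> [xiB|[_ []]//]; split=> //; exact: algU_wcat1.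
Qed.

Lemma shift_hat_continuous a xi : stone_basic (Zset X a) xi ->
  {for xi, continuous sigma}.
Proof.
move=> xia; apply: (subbase_continuous stone_subbase) => B UB.
move=> /(shift_hatE _ xia)[_ xiaB].
have UaB := algU_shift a UB.
suff : nbhs xi (stone_basic (Zset X a `&` @shift A @^-1` B)).
  apply: filterS => eta etaaB; apply/(shift_hatE (a := a)); last by split.
  by apply: stone_set_sub etaaB => [|x []//]; exact: algU_Zset.
apply: open_nbhs_nbhs; split=> //.
exact: (subbase_open stone_subbase).
Qed.

Lemma stone_cylinder_cons a w xi : stone_basic (cylinder (a :: w)) xi ->
  stone_basic (Zset X a) xi /\ stone_basic (cylinder w) (sigma xi).
Proof.
rewrite cylinder_cons => xiaw.
have xia : stone_basic (Zset X a) xi.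
  by apply: stone_set_sub xiaw => [|x []//]; exact: algU_Zset.
by split=> //; apply/(shift_hatE _ xia); split=> //; exact: algU_cylinder.
Qed.

Lemma cylinder_iter_dom w :
  stone_basic (cylinder w) `<=` iter_dom (@shift_hat_dom A X) sigma (size w).
Proof.
elim: w => [//|a w IH] xi /stone_cylinder_cons[xia xiw] /=.
by apply: iter_domS; [exists a|exact: IH].
Qed.

Lemma cylinder_iter_continuous w xi : stone_basic (cylinder w) xi ->
  {for xi, continuous (iter (size w) sigma)}.
Proof.
elim: w xi => [|a w IH] xi; first by move=> _; exact: cvg_id.
move=> /stone_cylinder_cons[xia xiw].
have -> : iter (size (a :: w)) sigma = iter (size w) sigma \o sigma.
  by apply/funext => eta; rewrite /= -iterS iterSr.
by apply: continuous_comp; [exact: shift_hat_continuous xia|exact: IH].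
Qed.

(** This formula carries both the injectivity of the iterate on the ultrafilters
    containing the cylinder and the continuity of its inverse. *)
Lemma cylinder_iter_wcat w xi B : stone_basic (cylinder w) xi -> algU X B ->
  stone_set xi B <-> stone_set (iter (size w) sigma xi) (wcat w @^-1` B).
Proof.
elim: w xi B => [|a w IH] xi B; first by rewrite preimage_wcat_nil.
move=> /stone_cylinder_cons[xia xiw] UB.
rewrite preimage_wcat_cons iterSr -IH//; last exact: algU_wcat1.
exact: shift_hat_wcat.
Qed.

Lemma cylinder_chart w B : algU X B -> B `<=` cylinder w ->
  iter_chart (@shift_hat_dom A X) sigma (size w) (stone_basic B).
Proof.
move=> UB Bw; set f := iter (size w) sigma.
have Bw' : stone_basic B `<=` stone_basic (cylinder w).
  by move=> xi; apply: stone_set_sub => //; exact: algU_cylinder.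
split; first exact: (subbase_open stone_subbase).
  by move=> xi /Bw'; exact: cylinder_iter_dom.
split.
  apply/subspace_continuousP => xi /Bw' xiw.
  by apply: cvg_within_filter; exact: cylinder_iter_continuous.
(* Off the image the value of the inverse is arbitrary. *)
pose h eta := if pselect (exists2 xi, stone_basic B xi & f xi = eta) is left e
  then sval (cid2 e) else eta.
have fK xi : stone_basic B xi -> h (f xi) = xi.
  move=> xiB; rewrite /h; case: pselect => [e|[]]; last by exists xi.
  case: cid2 => /= zeta zetaB fE; apply: stone_ext => C UC.
  rewrite (cylinder_iter_wcat (Bw' _ zetaB) UC).
  by rewrite (cylinder_iter_wcat (Bw' _ xiB) UC) -/f fE.
exists h; split; last by move=> xi /set_mem; exact: fK.
apply/subspace_continuousP => _ [xi xiB <-].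
apply: (subbase_cvg_map stone_subbase) => C UC.
rewrite /from_subspace -/f fK//.
move=> /(cylinder_iter_wcat (Bw' _ xiB) UC) xiC.
have UwC := algU_wcat w UC.
have : nbhs (f xi) (stone_basic (wcat w @^-1` C)).
  by apply: open_nbhs_nbhs; split=> //; exact: (subbase_open stone_subbase).
apply: filterS => eta etaC [zeta zetaB fE]; rewrite -fE /= fK//.
by apply/(cylinder_iter_wcat (Bw' _ zetaB) UC); rewrite -/f fE.
Qed.

(** An ultrafilter of sets of points of the Stone space converges to the point
    formed by the [C] whose basic open set it contains. *)
Lemma stone_compact B : algU X B -> compact (stone_basic B).
Proof.
move=> UB; rewrite compact_ultra => F FU FB.
have [UsubX UX UI UU UD] := boolean_subalgebra_algU X.
have xiP : ultrafilter_in (algU X) [set C | algU X C /\ F (stone_basic C)].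
  apply: (@prime_ultrafilter _ (points X)).
    split=> [C []//| |[_]|C E [UC FC] [UE FE]|C E [UC FC] UE CE].
    - by exists B.
    - suff -> : stone_basic set0 = set0 by exact: filter_not_empty.
      by rewrite -subset0 => xi; have [[]] := stoneP xi.
    - split; first exact: UI.
      by apply: filterS (filterI FC FE) => xi [??]; exact/stone_setI.
    - by split=> //; apply: filterS FC => xi; exact: stone_set_sub.
  move=> C UC; have [FC|FnC] := in_ultra_setVsetC (stone_basic C) FU.
    by left.
  right; split; first exact: UD.
  apply: filterS FnC => xi.
  by have [] := ultrafilter_prime (boolean_subalgebra_algU X) (stoneP xi) UC.
exists (Stone xiP); split=> //.
by apply: (subbase_cvg stone_subbase) => C UC [].
Qed.

Lemma principal_ultrafilter x : points X x ->
  ultrafilter_in (algU X) [set B | algU X B /\ B x].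
Proof.
move=> Xx; have [UsubX UX UI UU UD] := boolean_subalgebra_algU X.
apply: (@prime_ultrafilter _ (points X)).
  split=> [C []//| |[]//|C E [UC Cx] [UE Ex]|C E [UC Cx] UE CE].
  - by exists (points X).
  - by split=> //; exact: UI.
  - by split=> //; exact: CE.
move=> B UB; have [Bx|nBx] := pselect (B x); [by left|right].
by split=> //; exact: UD.
Qed.

Definition principal x (Xx : points X x) : stone X :=
  Stone (principal_ultrafilter Xx).

End subshift.

(** * Infinite subshifts *)

Lemma infinite_set_ord (T : choiceType) (S : set T) N : infinite_set S ->
  exists2 x : 'I_N -> T, injective x & forall i, S (x i).
Proof.
move=> /(infinite_set_fset N.+1)[B BS]; have Buniq := fset_uniq B.
(* [N.+1] elements ensure a default element even for [N = 0]. *)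
case Bs: (enum_fset B) => [//|x0 s] Nsize.
have i_lt (i : 'I_N) : (i < size (enum_fset B))%N.
  by rewrite Bs (leq_trans _ Nsize)// ltnS ltnW.
exists (fun i => nth x0 (enum_fset B) i).
  by move=> i j /eqP; rewrite nth_uniq// => /eqP/val_inj.
by move=> i; apply: BS; exact: mem_nth.
Qed.

(** Any length beyond [n] and beyond a coordinate of difference of each of the
    finitely many pairs will do. *)
Lemma separating_prefixes (A : Type) (N n : nat) (x : 'I_N -> nat -> A) :
  injective x -> exists2 k, (n <= k)%N &
  injective (fun i => mkseq (x i) k).
Proof.
move=> x_inj.
have /choice[d dP] : forall ij : 'I_N * 'I_N,
    exists d, ij.1 != ij.2 -> x ij.1 d <> x ij.2 d.
  move=> [i j] /=; have [->|/eqP ij] := eqVneq i j; first by exists 0%N.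
  have [d xd] : exists d, x i d <> x j d.
    apply: contra_notP ij => nd; apply/x_inj/funext => d.
    by apply: contra_notP nd => xd; exists d.
  by exists d.
exists (maxn n (\max_ij (d ij).+1)); first exact: leq_maxl.
move=> i j xij; apply/eqP; apply: contraT => ij.
have dk : (d (i, j) < maxn n (\max_ij (d ij).+1))%N.
  by rewrite leq_max; apply/orP; right; exact: (leq_bigmax (i, j)).
case: (dP (i, j) ij); have /(congr1 (fun s => nth (x i 0%N) s (d (i, j)))) := xij.
by rewrite !nth_mkseq.
Qed.

(** The compact open bisections are the graphs of the [n]-th iterate over the
    cylinders of long prefixes of [N] distinct points; each [g j] is the arrow
    of lag [n] whose range is the principal ultrafilter at the [j]-th point. *)
Lemma separated_bisections (A : countType) (X : subshift A) (N n : nat) :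
  infinite_set (points X) ->
  exists (S : 'I_N -> set (dr_groupoid (@shift_hat_dom A X) (@shift_hat A X)))
         (g : 'I_N -> dr_groupoid (@shift_hat_dom A X) (@shift_hat A X)),
  forall i,
    [/\ compact_open_bisection (S i), S i `<=` [set h | dr_lag h = n] &
        forall j, S i (g j) <-> i = j].
Proof.
move=> Xinf; have [x x_inj Xx] := infinite_set_ord N Xinf.
have [k nk xk_inj] := separating_prefixes n x_inj.
pose Z i := cylinder X (mkseq (x i) k).
have UZ i : algU X (Z i) by exact: algU_cylinder.
have Zx i j : Z i (x j) <-> i = j.
  rewrite /Z /cylinder /= size_mkseq; split=> [[_ /xk_inj]//|->].
  by split.
have Zn i : Z i `<=` cylinder X (mkseq (x i) n).
  move=> y [Xy]; rewrite size_mkseq => yk; split=> //.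
  have take_mkseq (z : nat -> A) : take n (mkseq z k) = mkseq z n.
    by rewrite -map_take take_iota (minn_idPl nk).
  by rewrite size_mkseq -!take_mkseq yk.
have Zchart i : iter_chart (@shift_hat_dom A X) (@shift_hat A X) n
    (stone_basic (Z i)).
  by have := cylinder_chart (UZ i) (Zn i); rewrite size_mkseq.
have g_ex i : exists g : dr_groupoid (@shift_hat_dom A X) (@shift_hat A X),
    dr_range g = principal (Xx i) /\
    iterate_graph n (stone_basic (Z i)) g.
  have xiZ : stone_basic (Z i) (principal (Xx i)) by split=> //; exact/Zx.
  have [_ /(_ _ xiZ) dom_n _] := Zchart i.
  by have [h] := iterate_graph_point dom_n xiZ; exists h.
have [g gP] := choice g_ex.
exists (fun i => iterate_graph n (stone_basic (Z i))), g => i; split.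
- apply: iterate_graph_bisection => //; first exact: stone_compact.
  move=> xi xiZ.
  have : stone_basic (cylinder X (mkseq (x i) n)) xi.
    by apply: stone_set_sub xiZ => //; exact: algU_cylinder.
  by move=> /cylinder_iter_continuous; rewrite size_mkseq.
- by move=> h /iterate_graphE[].
- move=> j; have [gj /iterate_graphE[_ gn gs]] := gP j.
  rewrite iterate_graphE gs gj; split=> [[[_ /Zx]]//|->].
  by split=> //; split=> //; exact/Zx.
Qed.

(** * Dimension of the homogeneous components *)

Section algebra.
Variables (K : fieldType) (A : countType) (X : subshift A).
Local Notation G := (dr_groupoid (@shift_hat_dom A X) (@shift_hat A X)).

Lemma finite_dimensional_subshift_algebra_deg m :
  finite_set (points X) -> ~ infinite_dimensional (subshift_algebra_deg K X m).
Proof.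
move=> Xfin; apply; eexists; last by [].
have [UsubX _ _ _ _] := boolean_subalgebra_algU X.
have fin_stone : finite_set [set: stone X].
  have : finite_set
      (@stone_set A X @^-1` [set V | V `<=` [set B | B `<=` points X]]).
    apply: finite_preimage; last exact/finite_powerset/finite_powerset.
    by move=> xi eta _ _ st; apply: stone_ext => B _; rewrite st.
  apply: sub_finite_set => xi _ B xiB; apply: UsubX.
  by have [[xiU _ _ _ _] _] := stoneP xi; exact: xiU.
have fin_deg : finite_set [set g : G | dr_lag g = m].
  pose f (g : G) := (dr_range g, (dr_lag g, dr_source g)).
  have : finite_set (f @^-1` ([set: stone X] `*` ([set m] `*` [set: stone X]))).
    apply: finite_preimage => [g h _ _ []|]; first exact: dr_groupoid_eq.
    by do 2![apply: finite_setX => //]; exact: finite_set1.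
  by apply: sub_finite_set.
apply: (@sub_finite_set _ _ ((fun U : set G => (\1_U : G -> K^o)) @`
    [set U | U `<=` [set g | dr_lag g = m]])).
  by move=> _ [U [_ Um] ->]; exists U.
exact/finite_image/finite_powerset.
Qed.

Lemma infinite_dimensional_subshift_algebra_deg m :
  infinite_set (points X) -> infinite_dimensional (subshift_algebra_deg K X m).
Proof.
move=> Xinf; apply: infinite_dimensional_dual => N.
suff [S [g Sg]] : exists (S : 'I_N -> set G) (g : 'I_N -> G), forall i,
    [/\ compact_open_bisection (S i), S i `<=` [set h | dr_lag h = m] &
        forall j, S i (g j) <-> i = j].
  exists (fun i => \1_(S i)), g => i; have [Si Sim gS] := Sg i; split.
    by apply: lin_span_mem; exists (S i).
  move=> j; rewrite indicE; congr (_%:R); congr nat_of_bool.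
  by apply/idP/eqP => [/set_mem/gS|/gS/mem_set].
case: m => n; first exact: separated_bisections.
have [S [g Sg]] := separated_bisections N n.+1 Xinf.
exists (fun i => @dr_inv _ _ _ @^-1` S i), (fun i => dr_inv (g i)) => i.
have [Si Sin gS] := Sg i; split; first exact: compact_open_bisection_inv.
- by move=> h /Sin /= hn; rewrite NegzE -hn opprK.
- by move=> j; rewrite /= dr_invK.
Qed.

End algebra.

Theorem theorem6p19 (K : fieldType) (A : countType) (X : subshift A) :
  [<-> forall m : int, infinite_dimensional (subshift_algebra_deg K X m);
       exists m : int, infinite_dimensional (subshift_algebra_deg K X m);
       infinite_set (points X)].
Proof.
tfae.
- by move=> inf; exists 0.
- by move=> [m + Xfin]; exact: finite_dimensional_subshift_algebra_deg.
- by move=> Xinf m; exact: infinite_dimensional_subshift_algebra_deg.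
Qed.
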